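(* Let $\mathcal S$ be an aperiodic $\mathbf q$-substitution on $\mathcal A$ with index of imprimitivity $1$, let $\mu\in\mathcal M(X_{\mathcal S},T)$, and let $\Sigma$ be its correlation vector. Then for every $p\in\mathbb N$ and $\mathbf k\in\mathbb Z^d$, $$\widehat\Sigma(\mathbf k)=\frac1{Q^p}\sum_{\mathbf j\in[\mathbf 0,\mathbf q^p)}\mathcal R^{(p)}_{\mathbf j}\otimes\mathcal R^{(p)}_{\mathbf j+\mathbf k}\ \widehat\Sigma\big(\lfloor\mathbf j+\mathbf k\rfloor_p\big)=\lim_{n\to\infty}\frac1{Q^n}\sum_{\mathbf j\in[\mathbf 0,\mathbf q^n)}\mathcal R^{(n)}_{\mathbf j}\otimes\mathcal R^{(n)}_{\mathbf j+\mathbf k}\ \widehat\Sigma(\mathbf 0).$$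
   Context: Conventions: fix $d\ge1$; operations and inequalities on $\mathbb Z^d$ are coordinatewise, $[\mathbf a,\mathbf b)=\{\mathbf j:a_i\le j_i<b_i\}$. Fix $\mathbf q\in\mathbb Z^d$ with all $q_i\ge2$, $Q=q_1\cdots q_d$, $\mathbf q^n=(q_1^n,\dots,q_d^n)$. For $\mathbf k\in\mathbb Z^d$, $n\ge0$, $\lceil\mathbf k\rceil_n\in[\mathbf 0,\mathbf q^n)$ and $\lfloor\mathbf k\rfloor_n\in\mathbb Z^d$ are the unique elements with $\mathbf k=\lceil\mathbf k\rceil_n+\lfloor\mathbf k\rfloor_n\mathbf q^n$. Substitutions: $\mathcal A$ is a finite alphabet with at least two letters; $\mathcal A^{\mathbb Z^d}$ has the product topology and the shift $(T^{\mathbf k}A)(\mathbf j)=A(\mathbf j+\mathbf k)$. A block is a map from a finite subset of $\mathbb Z^d$ to $\mathcal A$. A $\mathbf q$-substitution $\mathcal S$ assigns to each letter $\gamma$ a block $\mathcal S(\gamma):[\mathbf 0,\mathbf q)\to\mathcal A$; it extends to blocks and sequences by $(\mathcal S\omega)(\mathbf j)=\mathcal S(\omega(\lfloor\mathbf j\rfloor_1))(\lceil\mathbf j\rceil_1)$. $X_{\mathcal S}$ is the set of sequences all of whose finite sub-blocks occur, up to translation, as sub-blocks of some $\mathcal S^n(\gamma)$, $n\in\mathbb N$, $\gamma\in\mathcal A$. $\mathcal S$ is aperiodic if $T^{\mathbf k}A=A$ with $A\in X_{\mathcal S}$ implies $\mathbf k=\mathbf 0$. $[\alpha]=\{A\in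 X_{\mathcal S}:A(\mathbf 0)=\alpha\}$. $\mathcal M(X_{\mathcal S},T)$ is the set of $T$-invariant Borel probability measures on $X_{\mathcal S}$. Index of imprimitivity: there are $h>0$ and a partition $\mathcal A=\mathcal E_1\sqcup\cdots\sqcup\mathcal E_K\sqcup\mathcal T$ such that $\mathcal S^h$ restricts to a primitive substitution on each $\mathcal E_i$ (some power of it produces every letter of $\mathcal E_i$ from every letter of $\mathcal E_i$) and, for $\gamma\in\mathcal T$, $\mathcal S^h(\gamma)$ contains a letter not in $\mathcal T$; the least such $h$ is the index of imprimitivity. Generalized instructions: for $n\ge0$ and $\mathbf j\in[\mathbf 0,\mathbf q^n)$, $\mathcal R^{(n)}_{\mathbf j}:\mathcal A\to\mathcal A$ is $\gamma\mapsto(\mathcal S^n\gamma)(\mathbf j)$; for general $\mathbf j\in\mathbb Z^d$ put $\mathcal R^{(n)}_{\mathbf j}=\mathcal R^{(n)}_{\lceil\mathbf j\rceil_n}$. It is identified with the $\mathcal A\times\mathcal A$ matrix whose $(\alpha,\gamma)$ entry is $1$ if $\alpha=\mathcal R^{(n)}_{\mathbf j}(\gamma)$ and $0$ otherwise. The Kronecker product is $(A\otimes B)_{\alpha\beta,\gamma\delta}=A_{\alpha\gamma}B_{\beta\delta}$, an $\mathcal A^2\times\mathcal A^2$ matrix. Correlation vector: $\sigma_{\alpha\beta}$ is the complex measure on $\mathbb T^d$ with Fourier coefficients $\widehat{\sigma_{\alpha\beta}}(\mathbf k)=\int z_1^{-k_1}\cdots z_d^{-k_d}\,d\sigma_{\alpha\beta}=\int\mathbb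 1_{[\alpha]}\circ T^{-\mathbf k}\cdot\mathbb 1_{[\beta]}\,d\mu=\mu([\alpha]\cap T^{-\mathbf k}[\beta])$, and $\Sigma=\sum_{\alpha\beta\in\mathcal A^2}\sigma_{\alpha\beta}\mathbf e_{\alpha\beta}$, a $\mathbb C^{\mathcal A^2}$-valued measure with $\widehat\Sigma(\mathbf k)=\sum\widehat{\sigma_{\alpha\beta}}(\mathbf k)\mathbf e_{\alpha\beta}$. *)

(* Defs.v *)
From HB Require Import structures.
From mathcomp Require Import all_boot all_order all_algebra.
From mathcomp Require Import all_classical all_reals all_analysis.
From mathcomp Require Import complex mxtens.

Set Implicit Arguments.
Unset Strict Implicit.
Unset Printing Implicit Defensive.

Import Order.TTheory GRing.Theory Num.Theory.
Import numFieldNormedType.Exports.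
Local Open Scope classical_set_scope.
Local Open Scope ring_scope.

(* The sigma-algebras of MathComp-Analysis live on pointed types, so alphabets
   are finite types with a chosen letter; the choice is never used. *)
#[short(type="alphabetType")]
HB.structure Definition Alphabet := {A of Finite A & isPointed A}.

Notation Zd d := {ffun 'I_d -> int}.

(* A block is a map on a finite subset of Z^d and a sequence is a map on Z^d;
   both are handled as partial maps, with None outside of the domain. *)
Definition pconfig (d : nat) (A : Type) : Type := Zd d -> option A.

Section Lattice.
Context {d : nat}.
Implicit Types (b q k j : Zd d) (n : nat).

Definition box b : set (Zd d) := [set j | forall i, 0 <= j i < b i].

Definition zmul k j : Zd d := [ffun i => k i * j i].

Definition zpow q n : Zd d := [ffun i => q i ^+ n].

Definition zceil q n k : Zd d := [ffun i => (k i %% (q i ^+ n))%Z].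

Definition zfloor q n k : Zd d := [ffun i => (k i %/ (q i ^+ n))%Z].

Definition vol q : int := \prod_(i < d) q i.

Lemma box_zpow_finite q n : finite_set (box (zpow q n)).
Proof.
pose emb (f : {dffun forall i : 'I_d, 'I_`|zpow q n i|%N}) : Zd d :=
  [ffun i => (f i : nat)%:Z].
apply: (@sub_finite_set _ _ (emb @` setT)); last first.
  by apply: finite_image; exact: finite_finset.
move=> j jb.
have ltj i : (`|j i| < `|zpow q n i|)%N.
  have /andP[j0 jq] := jb i.
  by case: (j i) j0 jq => // m _; case: (zpow q n i).
exists [ffun i => Ordinal (ltj i)] => //.
apply/ffunP => i; rewrite ffunE (ffunE (fun i => Ordinal (ltj i))) /=.
by have /andP[] := jb i; case: (j i).
Qed.

(* zceil and zfloor are the unique remainder in [0, q^n) and quotient. *)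
Lemma zceil_zfloorP q n k r f : (forall i, 2 <= q i) ->
  (box (zpow q n) r /\ k = r + zmul f (zpow q n)) <->
  (r = zceil q n k /\ f = zfloor q n k).
Proof.
move=> q2.
have qn0 i : 0 < q i ^+ n by apply: exprn_gt0; exact: lt_le_trans (q2 i).
split=> [[rb ->]|[-> ->]].
  split; apply/ffunP => i; rewrite !ffunE.
    rewrite [in RHS]addrC modzMDl modz_small //.
    by have := rb i; rewrite ffunE.
  rewrite [in RHS]addrC divzMDl ?gt_eqF// divz_small ?addr0//.
  by have := rb i; rewrite ffunE abszE gtr0_norm.
split=> [i|].
  by rewrite !ffunE modz_ge0 ?gt_eqF//= ltz_pmod.
by apply/ffunP => i; rewrite !ffunE addrC -divz_eq.
Qed.

End Lattice.

Section Substitution.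
Context {d : nat} {A : alphabetType}.
Variable q : Zd d.
Implicit Types (S : A -> pconfig d A) (w : pconfig d A) (x : Zd d -> A).
Implicit Types (k j : Zd d) (n h : nat).

Definition is_substitution S :=
  forall (g : A) j, isSome (S g j) <-> box q j.

Definition subst S w : pconfig d A :=
  fun j => obind (fun g => S g (zceil q 1 j)) (w (zfloor q 1 j)).

Definition letter (g : A) : pconfig d A :=
  fun j => if j == 0 then Some g else None.

Definition subst_pow S n (g : A) : pconfig d A := iter n (subst S) (letter g).

Lemma subst_pow_dom S n (g : A) j : (forall i, 2 <= q i) ->
  is_substitution S -> isSome (subst_pow S n g j) <-> box (zpow q n) j.
Proof.
move=> q2 HS; rewrite /subst_pow.
have q0 i : 0 < q i by exact: lt_le_trans (q2 i).
elim: n j => [|n IH] j /=.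
  rewrite /letter; case: eqP => [->|j0]; split=> //.
    by move=> _ i; rewrite !ffunE expr0.
  move=> jb; exfalso; apply: j0; apply/ffunP => i.
  have := jb i; rewrite !ffunE expr0.
  by case: (j i) => [[|m]|m].
have -> : box (zpow q n.+1) j <-> box (zpow q n) (zfloor q 1 j).
  have E i : (0 <= j i < q i ^+ n.+1) = (0 <= (j i %/ q i)%Z < q i ^+ n).
    by rewrite divz_ge0 // ltz_divLR // exprSr.
  split=> jb i; have := jb i; rewrite !ffunE ?expr1 E //.
rewrite -IH /subst; case: (iter _ _ _ _) => [g'|] //=.
split=> // _; apply/HS => i.
by rewrite !ffunE expr1 modz_ge0 ?gt_eqF//= ltz_pmod.
Qed.

Definition zshift k x : Zd d -> A := fun j => x (j + k).

Definition subst_space S : set (Zd d -> A) :=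
  [set x | forall F : set (Zd d), finite_set F ->
     exists n (g : A) (t : Zd d),
       forall j, F j -> subst_pow S n g (j + t) = Some (x j)].

Definition aperiodic S :=
  forall x k, subst_space S x -> zshift k x = x -> k = 0.

Definition letters w : set A := [set a | exists j, w j = Some a].

(* The n-th power of S^h is S^(h n). *)
Definition primitive_on S h (E : {set A}) :=
  (forall g, g \in E -> letters (subst_pow S h g) `<=` [set` E]) /\
  (exists n, (0 < n)%N /\
     forall g, g \in E -> [set` E] `<=` letters (subst_pow S (h * n) g)).

Definition has_imprimitivity_partition S h :=
  exists (E : {set {set A}}) (T : {set A}),
    [/\ finset.partition E (~: T),
        forall C, C \in E -> primitive_on S h C &
        forall g, g \in T ->
          exists a, letters (subst_pow S h g) a /\ a \notin T].

Definition index_of_imprimitivity S h :=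
  [/\ (0 < h)%N, has_imprimitivity_partition S h &
      forall h', (0 < h')%N -> has_imprimitivity_partition S h' -> (h <= h')%N].

(* By subst_pow_dom, the default value g is never used. *)
Definition instruction S n j (g : A) : A :=
  odflt g (subst_pow S n g (zceil q n j)).

Definition instruction_mx (R : realType) S n j : 'M[R[i]]_#|A| :=
  \matrix_(a, c) (enum_val a == instruction S n j (enum_val c))%:R.

End Substitution.

Notation borel T := (g_sigma_algebraType (@open T)).

Definition seqspace (d : nat) (A : Type) : Type :=
  prod_topology (fun _ : Zd d => discrete_topology A).
HB.instance Definition _ d (A : alphabetType) :=
  Topological.on (seqspace d A).
HB.instance Definition _ d (A : alphabetType) :=
  isPointed.Build (seqspace d A) (fun=> point).

Section Invariant.
Context {d : nat} {A : alphabetType} {R : realType}.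
Variables (q : Zd d) (S : A -> pconfig d A).

(* Measures on the closed subset X_S are measures on the full shift that are
   carried by X_S. *)
Definition invariant_measure (mu : probability (borel (seqspace d A)) R) :=
  mu (subst_space q S) = 1%E /\
  forall (k : Zd d) (U : set (borel (seqspace d A))),
    measurable U -> mu (zshift k @^-1` U) = mu U.

Definition cylinder (a : A) : set (Zd d -> A) :=
  subst_space q S `&` [set x | x 0 = a].

End Invariant.

(* The norm topology of the complex numbers, which the library only attaches
   to the alias R[i]^o. *)
HB.instance Definition _ (R : realType) := PseudoPointedMetric.copy R[i] R[i]^o.

Section Spectral.
Context {R : realType}.

Definition unit_vectors (d : nat) : set (prod_topology (fun _ : 'I_d => R[i])) :=
  [set z | forall i, `|z i| = 1].
Arguments unit_vectors d : clear implicits.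

Lemma unit_vectors1 d : (fun=> 1) \in unit_vectors d.
Proof. by apply/mem_set => i; rewrite normr1. Qed.

Definition torus (d : nat) : Type := set_type (unit_vectors d).
HB.instance Definition _ d := Topological.copy (torus d) (unit_vectors d).
HB.instance Definition _ d := isPointed.Build (torus d) (SigSub (unit_vectors1 d)).

Section ComplexMeasure.
Context {disp : measure_display} {T : measurableType disp}.

(* The complex measure re_charge + i im_charge. *)
Record complex_measure := ComplexMeasure {
  re_charge : {charge set T -> \bar R};
  im_charge : {charge set T -> \bar R} }.

(* The value does not depend on the chosen Hahn decomposition. *)
Definition charge_integral (nu : {charge set T -> \bar R}) (f : T -> R) : R :=
  let PN := cid (Hahn_decomposition nu) in
  let nuPN := projT2 (cid (projT2 PN)) in
  \int[jordan_pos nuPN]_x f x - \int[jordan_neg nuPN]_x f x.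

Definition complex_integral (s : complex_measure) (f : T -> R[i]) : R[i] :=
  let re x := complex.Re (f x) in
  let im x := complex.Im (f x) in
  Complex
    (charge_integral (re_charge s) re - charge_integral (im_charge s) im)
    (charge_integral (re_charge s) im + charge_integral (im_charge s) re).

End ComplexMeasure.
Arguments complex_measure {disp} T.

Definition fourier d (s : complex_measure (borel (torus d))) (k : Zd d) :
    R[i] :=
  complex_integral s (fun z => \prod_(i < d) val z i ^ (- k i)).

Context {d : nat} {A : alphabetType}.

(* The family Sigma a b of complex measures stands for the vector measure
   Sigma = \sum_(a, b) (Sigma a b) e_ab. *)
Definition is_correlation_vector (q : Zd d) (S : A -> pconfig d A)
    (mu : probability (borel (seqspace d A)) R)
    (Sigma : A -> A -> complex_measure (borel (torus d))) :=
  forall (a b : A) (k : Zd d),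
    fourier (Sigma a b) k =
    (fine (mu (cylinder q S a `&` zshift k @^-1` cylinder q S b)))%:C%C.

(* The row of e_ab is mxtens_index (enum_rank a, enum_rank b), the indexing used
   by the Kronecker product *t of mxtens. *)
Definition fourier_vector
    (Sigma : A -> A -> complex_measure (borel (torus d))) (k : Zd d) :
    'cV[R[i]]_(#|A| * #|A|) :=
  \col_x let ab := mxtens_unindex x in
    fourier (Sigma (enum_val ab.1) (enum_val ab.2)) k.

End Spectral.
Arguments complex_measure R {disp} T.
Arguments torus R d : clear implicits.

(* Main.v *)
(* Let E(g, k) be the integral of g(x_0, x_k) with respect to mu, for g defined on
   pairs of letters. The first identity says that E is fixed by the p-th
   renormalization operator. The pair frequencies f_n(a) of the block S^n(a)
   satisfy this identity up to f_{p+n}(a) - f_n(a), which tends to 0: up to boundary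
   terms f_{n+m} is U^m f_n for the letter-averaging operator U of S, and
   U^{m+p} - U^m tends to 0 because U contracts the oscillation on each primitive
   class, while the transient letters lose a fixed proportion of their weight at
   each step. A large window of a point of X_S is tiled by blocks S^n(a) up to few
   sites, so the defect in the identity is uniformly small on X_S, and it remains to
   integrate against mu. The limit follows with p = n, since the floor of j + k
   vanishes for all j in [0, q^n) outside of a set of density tending to 0. *)
Require Import Defs.
From HB Require Import structures.
From mathcomp Require Import all_boot all_order all_algebra.
From mathcomp Require Import all_classical all_reals all_analysis.
From mathcomp Require Import complex mxtens.
From mathcomp Require Import zify ring lra.
Import Order.TTheory GRing.Theory Num.Theory.
Import numFieldNormedType.Exports.
Local Open Scope classical_set_scope.
Local Open Scope ring_scope.

Set Implicit Arguments.
Unset Strict Implicit.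
Unset Printing Implicit Defensive.

(** * Enumeration of boxes and sums of products over them *)

Section BoxEnumeration.
Context {d : nat}.
Implicit Types b j : Zd d.

(** All coordinates share one ordinal type, bounded by the largest side, and [family] cuts each down
    to its own side; in this form products of sums distribute. *)
Definition box_enum b : seq (Zd d) :=
  [seq [ffun i => (f i : nat)%:Z]
     | f : {ffun 'I_d -> 'I_(\max_i `|b i|%N)}
        in family (fun i => [pred a : 'I_(\max_i `|b i|%N) | (a < `|b i|)%N])].

Lemma box_enum_uniq b : uniq (box_enum b).
Proof.
rewrite map_inj_in_uniq ?enum_uniq// => f g _ _ /ffunP fg.
by apply/ffunP => i; have := fg i; rewrite !ffunE => -[] /val_inj.
Qed.

Lemma mem_box_enum b j : (forall i, 0 <= b i) -> j \in box_enum b <-> box b j.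
Proof.
move=> b0; split=> [|jb].
  case/mapP => f; rewrite mem_enum => /familyP fb -> i.
  rewrite ffunE /=; have := fb i; rewrite inE; have := b0 i.
  by move: (nat_of_ord (f i)) (b i) => m z; lia.
have jb' i : (`|j i| < `|b i|)%N by have := jb i; lia.
have jm i : (`|j i| < \max_i `|b i|)%N.
  by apply: leq_trans (jb' i) _; exact: (leq_bigmax (F := fun i => `|b i|%N)).
apply/mapP; exists [ffun i => Ordinal (jm i)].
  by rewrite mem_enum; apply/familyP => i; rewrite inE ffunE /=.
by apply/ffunP => i; rewrite !ffunE /=; have := jb i; lia.
Qed.

Lemma sum_box_prod (R : comPzSemiRingType) b (F : 'I_d -> int -> R) :
  \sum_(j <- box_enum b) \prod_i F i (j i) =
  \prod_i \sum_(0 <= a < `|b i|) F i a%:Z.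
Proof.
rewrite big_map big_enum_cond /=.
under eq_bigl do rewrite andbT.
under eq_bigr do under eq_bigr do rewrite ffunE.
rewrite -(bigA_distr_big_dep
  (fun i => [pred a : 'I_(\max_i `|b i|%N) | (a < `|b i|)%N])
  (fun i (a : 'I_(\max_i `|b i|%N)) => F i (a : nat)%:Z)).
apply: eq_bigr => i _; rewrite big_mkord.
rewrite (big_ord_widen_cond (\max_i `|b i|%N) xpredT (fun a => F i a%:Z)) //.
exact: (leq_bigmax (F := fun i => `|b i|%N)).
Qed.

End BoxEnumeration.

(** * Digits in base [q]: remainders and quotients at successive levels *)

Section FloorCeil.
Context {d : nat} (q : Zd d).
Hypothesis q2 : forall i, 2 <= q i.
Implicit Types j k l s t : Zd d.

Lemma zpow_gt0 n i : 0 < zpow q n i.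
Proof. by rewrite ffunE exprn_gt0// (lt_le_trans _ (q2 i)). Qed.

Lemma zceil_box n k : box (zpow q n) (zceil q n k).
Proof.
by have [] :=
  (zceil_zfloorP n k (zceil q n k) (zfloor q n k) q2).2 (conj erefl erefl).
Qed.

Lemma zceil_zfloor n k : k = zceil q n k + zmul (zfloor q n k) (zpow q n).
Proof.
by have [] :=
  (zceil_zfloorP n k (zceil q n k) (zfloor q n k) q2).2 (conj erefl erefl).
Qed.

Lemma zceilMDl n s l : zceil q n (s + zmul l (zpow q n)) = zceil q n s.
Proof. by apply/ffunP => i; rewrite !ffunE addrC modzMDl. Qed.

Lemma zfloorMDl n s l :
  zfloor q n (s + zmul l (zpow q n)) = l + zfloor q n s.
Proof.
apply/ffunP => i; rewrite !ffunE addrC divzMDl//.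
by rewrite gt_eqF//; have := zpow_gt0 n i; rewrite ffunE.
Qed.

Lemma zfloor_box n s : zfloor q n s = 0 <-> box (zpow q n) s.
Proof.
split=> [E|sb].
  have sE := zceil_zfloor n s; rewrite E in sE.
  have -> : s = zceil q n s.
    by rewrite {1}sE; apply/ffunP => i; rewrite !ffunE mul0r addr0.
  exact: zceil_box.
have [|_ <- //] := (zceil_zfloorP n s s 0 q2).1.
by split=> //; apply/ffunP => i; rewrite !ffunE mul0r addr0.
Qed.

Lemma zceil_id n s : box (zpow q n) s -> zceil q n s = s.
Proof.
move=> sb; have [|<- //] := (zceil_zfloorP n s s 0 q2).1.
by split=> //; apply/ffunP => i; rewrite !ffunE mul0r addr0.
Qed.

Lemma zceil_add n s t :
  zceil q n (s + t) = zceil q n (zceil q n s + t).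
Proof. by apply/ffunP => i; rewrite !ffunE modzDml. Qed.

Lemma zfloorD n m s : zfloor q (n + m) s = zfloor q m (zfloor q n s).
Proof.
apply/ffunP => i; rewrite !ffunE exprD divzMA_ge0//.
by rewrite exprn_ge0// (le_trans _ (q2 i)).
Qed.

(** In base [q], both sides read the digits of [s] in positions [n] to [n + m - 1]. *)
Lemma zfloor_zceilD n m s :
  zfloor q n (zceil q (n + m) s) = zceil q m (zfloor q n s).
Proof.
(* Low [n] digits, next [m] digits, and the rest; uniqueness of division then identifies the first
   two summands as [zceil q (n + m) s]. *)
have E : s = zceil q n s + zmul (zceil q m (zfloor q n s)) (zpow q n)
            + zmul (zfloor q m (zfloor q n s)) (zpow q (n + m)).
  rewrite {1}(zceil_zfloor n s) {1}(zceil_zfloor m (zfloor q n s)).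
  by apply/ffunP => i; rewrite !ffunE exprD; ring.
have qE i : zpow q (n + m) i = zpow q n i * zpow q m i.
  by rewrite !ffunE exprD.
have B : box (zpow q (n + m))
    (zceil q n s + zmul (zceil q m (zfloor q n s)) (zpow q n)).
  move=> i; rewrite qE.
  have /andP[a0 a1] := zceil_box n s i.
  have /andP[b0 b1] := zceil_box m (zfloor q n s) i.
  rewrite ffunE [zmul _ _ i]ffunE.
  have := zpow_gt0 n i; set a := zceil _ _ _ _ in a0 a1 *.
  set b := zceil _ _ _ _ in b0 b1 *; set u := zpow _ _ _ in a1 *.
  set v := zpow _ _ _ in b1 *; move=> u0; apply/andP; split; first by nia.
  nia.
have [<- _] := (zceil_zfloorP (n + m) s _ _ q2).1 (conj B E).
by rewrite zfloorMDl (zfloor_box n (zceil q n s)).2 ?addr0//; exact: zceil_box.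
Qed.

Lemma zceil_zceilD n m s : zceil q n (zceil q (n + m) s) = zceil q n s.
Proof.
apply/ffunP => i; rewrite !ffunE; set Y := q i ^+ n.
rewrite [in RHS](divz_eq (s i) (q i ^+ (n + m))) exprD -/Y.
by rewrite mulrA (mulrAC _ Y) modzMDl.
Qed.

End FloorCeil.

(** * Averages over boxes and the density of carries *)

Section BoxMean.
Context {d : nat} (q : Zd d) {R : realType}.
Hypothesis q2 : forall i, 2 <= q i.
Implicit Types (j k l s t : Zd d) (h : Zd d -> R) (n m : nat).

Definition box_mean n h : R :=
  ((vol q)%:~R ^+ n)^-1 * \sum_(j <- box_enum (zpow q n)) h j.

Lemma mem_box_zpow n j : j \in box_enum (zpow q n) <-> box (zpow q n) j.
Proof. by apply: mem_box_enum => i; exact: ltW (zpow_gt0 q2 n i). Qed.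

Lemma vol_gt0 : 0 < (vol q)%:~R :> R.
Proof. by rewrite ltr0z prodr_gt0// => i _; rewrite (lt_le_trans _ (q2 i)). Qed.

Lemma vol_neq0 n : (vol q)%:~R ^+ n != 0 :> R.
Proof. by rewrite expf_neq0// gt_eqF// vol_gt0. Qed.

Lemma zpow_natE n i : `|zpow q n i|%N%:R = (q i)%:~R ^+ n :> R.
Proof.
have q0 : 0 <= q i by rewrite (le_trans _ (q2 i)).
rewrite ffunE -rmorphXn /=; have : 0 <= q i ^+ n by exact: exprn_ge0.
by case: (q i ^+ n).
Qed.

Lemma prod_zpow n : \prod_i `|zpow q n i|%N%:R = (vol q)%:~R ^+ n :> R.
Proof.
under eq_bigr do rewrite zpow_natE.
by rewrite prodrXl rmorph_prod.
Qed.

Lemma sum_box1 n : \sum_(j <- box_enum (zpow q n)) 1 = (vol q)%:~R ^+ n :> R.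
Proof.
transitivity (\sum_(j <- box_enum (zpow q n)) \prod_(i < d) (fun _ _ => 1) i (j i) : R).
  by apply: eq_bigr => j _; rewrite big1.
rewrite (sum_box_prod (zpow q n) (fun _ _ => 1)) -prod_zpow; apply: eq_bigr => i _.
by rewrite sumr_const_nat subn0.
Qed.

Lemma eq_box_mean n h h' : (forall j, box (zpow q n) j -> h j = h' j) ->
  box_mean n h = box_mean n h'.
Proof.
by move=> hh; congr (_ * _); apply: eq_big_seq => j /mem_box_zpow; exact: hh.
Qed.

Lemma ler_box_mean n h h' : (forall j, box (zpow q n) j -> h j <= h' j) ->
  box_mean n h <= box_mean n h'.
Proof.
move=> hh; rewrite ler_pM2l ?invr_gt0 ?exprn_gt0 ?vol_gt0//.
by rewrite big_seq [leRHS]big_seq ler_sum// => j /mem_box_zpow; exact: hh.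
Qed.

Lemma box_mean_cst n (c : R) : box_mean n (fun=> c) = c.
Proof.
rewrite /box_mean (eq_bigr (fun=> 1 * c)) => [|j _]; last by rewrite mul1r.
by rewrite -mulr_suml sum_box1 mulrA mulVf ?mul1r// vol_neq0.
Qed.

Lemma box_meanZ n (c : R) h : box_mean n (fun j => c * h j) = c * box_mean n h.
Proof. by rewrite /box_mean -mulr_sumr mulrCA. Qed.

Lemma box_meanB n h h' :
  box_mean n (fun j => h j - h' j) = box_mean n h - box_mean n h'.
Proof. by rewrite /box_mean sumrB mulrBr. Qed.

Lemma box_mean_sum n (I : Type) (r : seq I) (h : I -> Zd d -> R) :
  box_mean n (fun j => \sum_(i <- r) h i j) = \sum_(i <- r) box_mean n (h i).
Proof. by rewrite /box_mean exchange_big mulr_sumr. Qed.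

Lemma box_mean_exchange n m (h : Zd d -> Zd d -> R) :
  box_mean n (fun j => box_mean m (h j)) =
  box_mean m (fun l => box_mean n (h ^~ l)).
Proof. by rewrite [in RHS]/box_mean -box_mean_sum -box_meanZ. Qed.

Lemma ler_norm_box_mean n h : `|box_mean n h| <= box_mean n (fun j => `|h j|).
Proof.
rewrite /box_mean normrM gtr0_norm ?invr_gt0 ?exprn_gt0 ?vol_gt0//.
by rewrite ler_pM2l ?invr_gt0 ?exprn_gt0 ?vol_gt0// ler_norm_sum.
Qed.

Lemma ler_dist_box_mean n h h' (e : R) :
  (forall j, box (zpow q n) j -> `|h j - h' j| <= e) ->
  `|box_mean n h - box_mean n h'| <= e.
Proof.
move=> hh; rewrite -box_meanB (le_trans (ler_norm_box_mean _ _))//.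
by rewrite -[leRHS](box_mean_cst n); exact: ler_box_mean.
Qed.

(** A single site has weight Q^-n in the mean, so a smaller value there lowers the bound [a] by that
    share of [a - b]. The contraction estimates rest on this. *)
Lemma box_mean_le_pick n h (a b : R) s : box (zpow q n) s -> h s <= b ->
  (forall j, box (zpow q n) j -> h j <= a) ->
  box_mean n h <= a - ((vol q)%:~R ^+ n)^-1 * (a - b).
Proof.
move=> sb hsb ha.
(* The bound is the mean of the extremal function: [b] at [s], [a] elsewhere. *)
suff -> : a - ((vol q)%:~R ^+ n)^-1 * (a - b) =
    box_mean n (fun j => if j == s then b else a).
  by apply: ler_box_mean => j jb; case: eqP => [->//|_]; exact: ha.
rewrite -{1}(box_mean_cst n a) /box_mean -mulrBr; congr (_ * _).
have sE : s \in box_enum (zpow q n) by apply/mem_box_zpow.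
rewrite !(bigD1_seq s) ?box_enum_uniq//= eqxx.
rewrite [in RHS](eq_bigr (fun=> a)); last by move=> j /negbTE ->.
by rewrite addrAC opprB addrCA subrr addr0.
Qed.

Lemma box_mean_ge_pick n h (a b : R) s : box (zpow q n) s -> b <= h s ->
  (forall j, box (zpow q n) j -> a <= h j) ->
  a + ((vol q)%:~R ^+ n)^-1 * (b - a) <= box_mean n h.
Proof.
move=> sb hsb ha; rewrite -lerN2 -mulN1r -box_meanZ.
have -> : - (a + ((vol q)%:~R ^+ n)^-1 * (b - a)) =
    - a - ((vol q)%:~R ^+ n)^-1 * (- a - - b) by ring.
by apply: (box_mean_le_pick sb) => [|j jb]; rewrite mulN1r lerN2// ha.
Qed.

(** Uniqueness of base-[q] expansions: [s] holds the low [n] digits and [l] the high [m] digits. *)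
Lemma perm_box_enumD n m :
  perm_eq (box_enum (zpow q (n + m)))
    [seq s + zmul l (zpow q n)
       | l <- box_enum (zpow q m), s <- box_enum (zpow q n)].
Proof.
apply: uniq_perm; rewrite ?box_enum_uniq//.
  apply: allpairs_uniq; rewrite ?box_enum_uniq// => -[l s] [l' s'].
  move=> /allpairsP[[? ?] [_ /= /mem_box_zpow sb [-> ->]]].
  move=> /allpairsP[[? ?] [_ /= /mem_box_zpow sb' [-> ->]]] E.
  move: (congr1 (zceil q n) E) (congr1 (zfloor q n) E).
  rewrite !zceilMDl !zceil_id// !zfloorMDl// => ->.
  by rewrite !(zfloor_box q2 n _).2// !addr0 => ->.
move=> j; apply/idP/allpairsP => [/mem_box_zpow jb|]; last first.
  move=> [[l s] [/= /mem_box_zpow lb /mem_box_zpow sb ->]].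
  apply/mem_box_zpow/(zfloor_box q2); rewrite zfloorD// zfloorMDl//.
  by rewrite (zfloor_box q2 n s).2// addr0; apply/zfloor_box.
exists (zfloor q n j, zceil q n j); split=> /=.
- by apply/mem_box_zpow; rewrite -(zceil_id q2 jb) zfloor_zceilD//; exact: zceil_box.
- by apply/mem_box_zpow; exact: zceil_box.
- exact: zceil_zfloor.
Qed.

Lemma box_mean_add n m h :
  box_mean (n + m) h =
  box_mean m (fun l => box_mean n (fun s => h (s + zmul l (zpow q n)))).
Proof.
rewrite [LHS]/box_mean (perm_big _ (perm_box_enumD n m)) big_allpairs_dep.
by rewrite /box_mean exprD invfM -mulr_sumr mulrA (mulrC (_ ^+ m)^-1).
Qed.

(** Adding [k] permutes the residues modulo q^n. *)
Lemma box_mean_zceil n k h :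
  box_mean n (fun j => h (zceil q n (j + k))) = box_mean n h.
Proof.
rewrite /box_mean; congr (_ * _).
rewrite -[LHS](big_map (fun j => zceil q n (j + k)) xpredT); apply: perm_big.
apply: uniq_perm; rewrite ?box_enum_uniq//.
  rewrite map_inj_in_uniq ?box_enum_uniq// => i j /mem_box_zpow ib /mem_box_zpow jb ij.
  have unshift s : zceil q n s = zceil q n (zceil q n (s + k) - k).
    by rewrite -zceil_add addrK.
  by rewrite -(zceil_id q2 ib) -(zceil_id q2 jb) unshift ij -unshift.
move=> j; apply/mapP/idP => [[i _ ->]|/mem_box_zpow jb].
  by apply/mem_box_zpow; exact: zceil_box.
exists (zceil q n (j - k)); first by apply/mem_box_zpow; exact: zceil_box.
by rewrite -zceil_add subrK zceil_id.
Qed.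

(** By [zfloor_box], this is the proportion of sites [j] of the box for which [j + k] leaves the
    box. *)
Definition carry_density n k : R :=
  box_mean n (fun j => (zfloor q n (j + k) != 0)%:R).

Lemma carry_density_ge0 n k : 0 <= carry_density n k.
Proof. by rewrite -[leLHS](box_mean_cst n); apply: ler_box_mean. Qed.

Lemma sum_nat_lt (b c : nat) : (\sum_(0 <= a < b) (a < c) <= c)%N.
Proof.
rewrite big_mkord.
have -> : (\sum_(a < b) (a < c) = \sum_(a < b | a < c) 1)%N.
  by rewrite [RHS]big_mkcond; apply: eq_bigr => a _; case: ltnP.
have [bc|cb] := leqP b c.
  rewrite (leq_trans _ bc)// -[leqRHS]card_ord sum1_card; exact: max_card.
by rewrite -(big_ord_widen _ (fun=> 1%N) (ltnW cb)) sum1_card card_ord.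
Qed.

(** For [c >= 0] only the last [|c|] values of [a] can overflow, and for [c < 0] only the first
    [|c|] can underflow; reversing the sum reduces the first case to an initial segment. *)
Lemma sum_carry1 (b c : int) : 0 < b ->
  (\sum_(0 <= a < `|b|) ((a%:Z + c) %/ b != 0)%Z <= `|c|)%N.
Proof.
move=> b0; have [c0|c0] := leP 0 c.
  rewrite big_nat_rev /= (leq_trans _ (sum_nat_lt `|b| `|c|))//.
  rewrite big_nat [leqRHS]big_nat leq_sum// => a /andP[_ ab].
  have [|ca] := ltnP a `|c|%N; first by case: (_ != _).
  by rewrite divz_small//; lia.
rewrite (leq_trans _ (sum_nat_lt `|b| `|c|))//.
rewrite big_nat [leqRHS]big_nat leq_sum// => a /andP[_ ab].
have [|ca] := ltnP a `|c|%N; first by case: (_ != _).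
by rewrite divz_small//; lia.
Qed.

(** Union bound over the coordinates: in coordinate [i] at most [|k i|] of the [q i ^+ n >= 2 ^+ n]
    values carry. *)
Lemma carry_density_le n k :
  carry_density n k <= (\sum_i `|k i|%N%:R) / 2 ^+ n.
Proof.
pose bad i (a : int) : R := ((a + k i) %/ zpow q n i != 0)%Z%:R.
(* Writing the indicator of a carry in coordinate [i] as a product over all coordinates lets
   [sum_box_prod] factor its sum. *)
pose F (i l' : 'I_d) : int -> R := if l' == i then bad i else fun=> 1.
have prodF (i : 'I_d) j : \prod_(l' < d) F i l' (j l') = bad i (j i).
  rewrite (bigD1 i)//= /F eqxx big1 ?mulr1// => l /negbTE li.
  by rewrite li.
rewrite mulr_suml.
apply: (@le_trans _ _ (box_mean n (fun j => \sum_(i <- index_enum 'I_d) bad i (j i)))).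
  apply: ler_box_mean => j _; case: eqP => [_|/eqP jk].
    by rewrite sumr_ge0// => i _; rewrite /bad.
  have [i jki] : exists i, zfloor q n (j + k) i != 0.
    apply: contrapT => H; move/eqP: jk; apply; apply/ffunP => i.
    by apply: contrapT => /eqP; rewrite [X in _ != X]ffunE => ji; apply: H; exists i.
  rewrite (bigD1 i)//= (_ : bad i (j i) = 1) ?lerDl ?sumr_ge0//.
  by rewrite /bad; move: jki; rewrite !ffunE => ->.
rewrite box_mean_sum ler_sum// => i _.
rewrite /box_mean; under eq_bigr do rewrite -prodF.
rewrite sum_box_prod -prod_zpow !(bigD1 i (P := xpredT))//=.
rewrite {1}/F eqxx.
rewrite [X in _ * (_ * X)](eq_bigr (fun l' : 'I_d => `|zpow q n l'|%N%:R)); last first.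
  move=> l /negbTE li; by rewrite /F li sumr_const_nat subn0.
set P := \prod_(_ | _) _.
have P0 : 0 < P.
  by rewrite prodr_gt0// => l _; rewrite ltr0n; have := zpow_gt0 q2 n l; lia.
have Z0 : 0 < `|zpow q n i|%N%:R :> R.
  by rewrite ltr0n; have := zpow_gt0 q2 n i; lia.
rewrite invfM mulrACA mulVf ?gt_eqF// mulr1 mulrC.
have Z2 : 2 ^+ n <= `|zpow q n i|%N%:R :> R.
  by rewrite zpow_natE lerXn2r ?nnegrE ?ler0z ?(le_trans _ (q2 i))// (ler_int _ 2).
apply: ler_pM.
- by rewrite sumr_ge0// => a _; rewrite /bad.
- by rewrite invr_ge0 ltW.
- by rewrite /bad -natr_sum ler_nat sum_carry1// zpow_gt0.
- by rewrite lef_pV2 ?posrE// exprn_gt0.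
Qed.

Lemma carry_density_cvg0 k : carry_density n k @[n --> \oo] --> 0.
Proof.
apply: (@squeeze_cvgr _ _ _ _ (fun=> 0) (fun n => (\sum_i `|k i|%N%:R) / 2 ^+ n)).
- by apply: nearW => n; rewrite carry_density_ge0 carry_density_le.
- exact: cvg_cst.
- rewrite -[X in _ --> X](mulr0 (\sum_i `|k i|%N%:R)).
  apply: cvgMr; under eq_fun do rewrite -exprVn.
  by apply: cvg_expr; rewrite gtr0_norm ?invr_gt0// invf_lt1// ltr1n.
Qed.

(** Only the sites that carry contribute, each by at most 2. *)
Lemma box_mean_dist_carry n k h h' :
  (forall j, `|h j| <= 1) -> (forall j, `|h' j| <= 1) ->
  (forall j, box (zpow q n) j -> zfloor q n (j + k) = 0 -> h j = h' j) ->
  `|box_mean n h - box_mean n h'| <= 2 * carry_density n k.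
Proof.
move=> h1 h'1 hh; rewrite -box_meanB (le_trans (ler_norm_box_mean _ _))//.
rewrite -box_meanZ; apply: ler_box_mean => j jb.
case: eqP => [/(hh _ jb) ->|_]; first by rewrite subrr normr0 mulr0.
by rewrite mulr1 (le_trans (ler_normB _ _))// (_ : 2 = 1 + 1)// lerD.
Qed.

(** Cyclic translation preserves the mean exactly, and it differs from true translation only at
    sites that carry. *)
Lemma box_mean_translate n k h : (forall j, `|h j| <= 1) ->
  `|box_mean n (fun j => h (j + k)) - box_mean n h| <= 2 * carry_density n k.
Proof.
move=> h1; rewrite -[in X in _ - X](box_mean_zceil n k).
apply: box_mean_dist_carry => // j jb /(zfloor_box q2) jkb.
by rewrite zceil_id.
Qed.

End BoxMean.

(** * Composition of instructions and desubstitution *)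

Section Instructions.
Context {d : nat} {A : alphabetType} (q : Zd d) (S : A -> pconfig d A).
Hypothesis q2 : forall i, 2 <= q i.
Hypothesis substS : is_substitution q S.
Implicit Types (j k l s t : Zd d) (n m p : nat) (g : A).

Lemma iter_subst n (w : pconfig d A) j :
  iter n (subst q S) w j =
  obind (fun g => subst_pow q S n g (zceil q n j)) (w (zfloor q n j)).
Proof.
elim: n w j => [|n IH] w j /=.
  have -> : zfloor q 0 j = j by apply/ffunP => i; rewrite ffunE expr0 divz1.
  case: (w j) => //= g; rewrite /subst_pow /= /letter ifT//.
  by apply/eqP/ffunP => i; rewrite !ffunE expr0 modz1.
rewrite /subst IH -(zfloorD q2 1 n); case: (w _) => //= g.
by rewrite /subst_pow /= /subst (zfloor_zceilD q2 1 n) zceil_zceilD.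
Qed.

Lemma subst_powE n j g :
  subst_pow q S n g (zceil q n j) = Some (instruction q S n j g).
Proof.
have /(subst_pow_dom n g _ q2 substS) := zceil_box q2 n j.
by rewrite /instruction; case: (subst_pow _ _ _ _ _).
Qed.

(** Since S^(n+m) = S^n S^m, the higher digits of [j] select a letter of S^m(g), and the low [n]
    digits select a letter in the S^n-block of that one. *)
Lemma instructionD n m j g :
  instruction q S (n + m) j g =
  instruction q S n j (instruction q S m (zfloor q n j) g).
Proof.
apply: Some_inj; rewrite -subst_powE {1}/subst_pow iterD iter_subst.
by rewrite -/(subst_pow q S m g) zfloor_zceilD// subst_powE /= zceil_zceilD subst_powE.
Qed.

Lemma instruction_zceil n j g :
  instruction q S n (zceil q n j) g = instruction q S n j g.
Proof. by rewrite /instruction zceil_id//; exact: zceil_box. Qed.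

Lemma instructionMDl n s l g :
  instruction q S n (s + zmul l (zpow q n)) g = instruction q S n s g.
Proof. by rewrite /instruction zceilMDl. Qed.

Lemma lettersP n g (a : A) :
  letters (subst_pow q S n g) a <->
  exists2 l, box (zpow q n) l & instruction q S n l g = a.
Proof.
split=> [[l lE]|[l lb <-]]; last first.
  by exists l; rewrite -{1}(zceil_id q2 lb) subst_powE.
have lb : box (zpow q n) l by apply/(subst_pow_dom n g _ q2 substS); rewrite lE.
by exists l => //; apply: Some_inj; rewrite -subst_powE zceil_id.
Qed.

(* A finite version of the desubstitution x = T^t0 (S^n y). *)
Lemma subst_space_desubst (x : Zd d -> A) n (F : set (Zd d)) : (0 < d)%N ->
  subst_space q S x -> finite_set F ->
  exists (t : Zd d) (y : Zd d -> A), box (zpow q n) t /\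
    forall j, F j -> x j = instruction q S n (j + t) (y (zfloor q n (j + t))).
Proof.
move=> d0 xS Ffin.
(* The two extra sites force [n <= N]: their translates both lie in [0, q^N), which therefore has
   sides longer than those of [0, q^n]. A coordinate to compare exists since [0 < d]. *)
have [|N [g [t xE]]] := xS (F `|` [set 0; zpow q n]).
  by rewrite finite_setU; split=> //; exact: finite_set2.
have tb j : (F `|` [set 0; zpow q n]) j -> box (zpow q N) (j + t).
  by move=> /xE jE; apply/(subst_pow_dom N g _ q2 substS); rewrite jE.
have nN : (n <= N)%N.
  have := tb 0 (or_intror (or_introl erefl)) (Ordinal d0).
  have := tb _ (or_intror (or_intror erefl)) (Ordinal d0).
  rewrite !ffunE => /andP[_ h1] /andP[h2 _]; rewrite leqNgt; apply/negP => Nn.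
  have := ler_weXn2l (le_trans (_ : 1 <= 2) (q2 (Ordinal d0))) (ltnW Nn).
  move=> /(_ isT); lia.
(* The remainder of [t] places the window inside a level-[n] block, and its quotient is absorbed
   into [y], which reads S^(N-n)(g). *)
exists (zceil q n t), (fun l => instruction q S (N - n) (l + zfloor q n t) g).
split=> [|j Fj]; first exact: zceil_box.
apply: Some_inj; rewrite -xE; last by left.
have jb := tb j (or_introl Fj).
rewrite -{1}(zceil_id q2 jb) subst_powE; congr Some.
rewrite -{1}(subnKC nN) instructionD {1 2}(zceil_zfloor q2 n t) !addrA.
by rewrite instructionMDl zfloorMDl// [_ + zfloor _ _ _]addrC.
Qed.

End Instructions.

(** * Pair averages and letter averages under substitution *)

Section PairMeans.
Context {d : nat} {A : alphabetType} (q : Zd d) (S : A -> pconfig d A) {R : realType}.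
Hypothesis q2 : forall i, 2 <= q i.
Hypothesis substS : is_substitution q S.
Implicit Types (j k l s t : Zd d) (n m p : nat) (a : A) (g : A -> A -> R).
Implicit Types (x y : Zd d -> A) (h : A -> R).

Local Notation I := (instruction q S).
Local Notation mean := (@box_mean d q R).
Local Notation carry := (@carry_density d q R).

Definition pair_mean n x g k : R := mean n (fun j => g (x j) (x (j + k))).

(** This is S^n y, for a total sequence [y]. *)
Definition subst_seq n y j := I n j (y (zfloor q n j)).

(** The transpose of R_s tensor R_t, acting on functions of pairs of letters. *)
Definition pull_pair n s t g a b := g (I n s a) (I n t b).

(** At the sites s + l q^p and s + k + l q^p, S^p y has the letters R_s(y_l) and R_(s+k)(y_(l + v)),
    where v is the floor of s + k. The identity is exact because pairs across blocks are kept. *)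
Lemma pair_mean_subst p n y g k :
  pair_mean (p + n) (subst_seq p y) g k =
  mean p (fun s => pair_mean n y (pull_pair p s (s + k) g) (zfloor q p (s + k))).
Proof.
rewrite /pair_mean box_mean_add// box_mean_exchange.
apply: eq_box_mean => // s sb; apply: eq_box_mean => // l _.
rewrite /subst_seq /pull_pair addrAC !instructionMDl !zfloorMDl//.
by rewrite (zfloor_box q2 p s).2// addr0.
Qed.

(** A pair inside one block S^n(y_l) depends on y_l alone; the pairs straddling two blocks have
    density [carry n k]. *)
Lemma pair_mean_coarse n m y g k : (forall a b, `|g a b| <= 1) ->
  `|pair_mean (n + m) (subst_seq n y) g k -
    mean m (fun l => pair_mean n (fun s => I n s (y l)) g k)| <= 2 * carry n k.
Proof.
move=> g1; rewrite /pair_mean box_mean_add//.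
apply: ler_dist_box_mean => // l _; apply: box_mean_dist_carry => // s sb sk.
rewrite /subst_seq addrAC !instructionMDl !zfloorMDl//.
by rewrite (zfloor_box q2 n s).2// sk addr0.
Qed.

(** The power U^n of the letter-averaging operator, by [letter_meanD]. *)
Definition letter_mean n h a : R := mean n (fun l => h (I n l a)).

Lemma letter_meanD n m h a :
  letter_mean (n + m) h a = letter_mean m (letter_mean n h) a.
Proof.
rewrite /letter_mean box_mean_add//; apply: eq_box_mean => // l _.
apply: eq_box_mean => // s sb; rewrite instructionD// instructionMDl//.
by rewrite zfloorMDl// (zfloor_box q2 n s).2// addr0.
Qed.

Lemma letter_mean0 h a : letter_mean 0 h a = h a.
Proof.
rewrite /letter_mean -[RHS](box_mean_cst q2 0); apply: eq_box_mean => // l _.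
congr h; apply: Some_inj; rewrite -subst_powE// /subst_pow /= /letter.
by rewrite (_ : zceil _ _ _ = 0) ?eqxx//; apply/ffunP => i; rewrite !ffunE expr0 modz1.
Qed.

End PairMeans.

(** * Asymptotic regularity of the letter averages *)

Section LetterMeans.
Context {d : nat} {A : alphabetType} (q : Zd d) (S : A -> pconfig d A) {R : realType}.
Hypothesis q2 : forall i, 2 <= q i.
Hypothesis substS : is_substitution q S.
Implicit Types (j k l s t : Zd d) (n m p r : nat) (a b : A) (h : A -> R).

Local Notation I := (instruction q S).
Local Notation U := (@letter_mean d A q S R).
Local Notation eta n := (((vol q)%:~R ^+ n)^-1 : R).

Lemma eta_gt0 n : 0 < eta n.
Proof. by rewrite invr_gt0 exprn_gt0// vol_gt0. Qed.

Lemma eta_le1 n : eta n <= 1.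
Proof.
rewrite invf_le1 ?exprn_gt0 ?vol_gt0// exprn_ege1// (ler_int _ 1).
by have := vol_gt0 (R := R) q2; rewrite ltr0z; lia.
Qed.

Lemma eta_shrink n (c e : R) : 0 < e ->
  exists r, c * (1 - eta n) ^+ r <= e.
Proof.
move=> e0.
have : c * (1 - eta n) ^+ r @[r --> \oo] --> 0.
  rewrite -[X in _ --> X](mulr0 c); apply: cvgMr; apply: cvg_expr.
  by rewrite ger0_norm ?subr_ge0 ?eta_le1// ltrBlDr ltrDl eta_gt0.
move=> /cvgrPdist_le /(_ _ e0)[r _ /(_ r (leqnn r)) /= re]; exists r.
by rewrite (le_trans _ re)// sub0r normrN ler_norm.
Qed.

Section Class.
Variables (C : {set A}) (c : A) (n0 : nat).
Hypothesis closedC : forall a l, a \in C -> I 1 l a \in C.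
Hypothesis reachC : forall a, a \in C -> exists2 l, box (zpow q n0) l & I n0 l a = c.

Lemma instruction_closed n a l : a \in C -> I n l a \in C.
Proof.
elim: n a l => [|n IH] a l aC.
  rewrite (_ : I 0 l a = a)//; apply: Some_inj; rewrite -subst_powE//.
  rewrite /subst_pow /= /letter (_ : zceil _ _ _ = 0) ?eqxx//.
  by apply/ffunP => i; rewrite !ffunE expr0 modz1.
by rewrite -addn1 instructionD//; exact/IH/closedC.
Qed.

Lemma letter_mean_in n h (x y : R) : (forall a, a \in C -> x <= h a <= y) ->
  forall a, a \in C -> x <= U n h a <= y.
Proof.
move=> hxy a aC; have hl l := andP (hxy _ (instruction_closed n l aC)).
apply/andP; split; [rewrite -[leLHS](box_mean_cst q2 n)
                   |rewrite -[leRHS](box_mean_cst q2 n)];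
  by apply: ler_box_mean => // l _; have [] := hl l.
Qed.

(** Doeblin's argument: for every [a] in [C], the mean gives weight at least [eta n0] to the same
    value [h c], so both ends of the enclosing interval move towards [h c]. *)
Lemma letter_mean_contract h (x w : R) :
  (forall a, a \in C -> x <= h a <= x + w) ->
  exists x', forall a, a \in C -> x' <= U n0 h a <= x' + w * (1 - eta n0).
Proof.
move=> hx; exists (x + eta n0 * (h c - x)) => a aC; have [l lb lc] := reachC aC.
apply/andP; split.
  apply: (box_mean_ge_pick q2 lb) => [|j _]; first by rewrite lc.
  by have /andP[] := hx _ (instruction_closed n0 j aC).
have -> : x + eta n0 * (h c - x) + w * (1 - eta n0) =
  (x + w) - eta n0 * (x + w - h c) by ring.
apply: (box_mean_le_pick q2 lb) => [|j _]; first by rewrite lc.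
by have /andP[] := hx _ (instruction_closed n0 j aC).
Qed.

(** After [r] contractions the values on [C] lie in an interval of length at most [e]; later
    averages stay in it, those at [m] and [m + p] included. *)
Lemma letter_mean_class_cvg h (e : R) p : (forall a, `|h a| <= 1) -> 0 < e ->
  \forall m \near \oo, forall a, a \in C -> `|U (m + p) h a - U m h a| <= e.
Proof.
move=> h1 e0; have [r re] := eta_shrink n0 2 e0.
have [x hx] : exists x, forall a, a \in C ->
    x <= U (r * n0) h a <= x + 2 * (1 - eta n0) ^+ r.
  elim: (r) => [|r' [x hx]].
    (* The initial interval is [-1, 1], of width 2. *)
    exists (-1) => a _; rewrite mul0n letter_mean0// expr0.
    by have := h1 a; rewrite ler_norml; lra.
  have [x' hx'] := letter_mean_contract hx; exists x' => a aC.
  by rewrite mulSnr letter_meanD// exprSr mulrA; exact: hx'.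
exists (r * n0)%N => // m /= rm a aC.
have hm b : b \in C -> x <= U m h b <= x + e.
  move=> bC; rewrite -(subnKC rm) letter_meanD//; apply: letter_mean_in => // b' b'C.
  by have := hx _ b'C; lra.
rewrite letter_meanD//; have := hm _ aC; have := letter_mean_in p hm aC.
by rewrite ler_norml; lra.
Qed.

End Class.

(** On the primitive classes the difference D_m = U^(m+p) h - U^m h is eventually at most e/2. For a
    transient letter [a], D_(m+1)(a) is the mean of D_m over S(a), which contains a letter outside
    [T]; the excess of the bound over e/2 thus shrinks by the factor 1 - 1/Q. *)
Lemma letter_mean_regular h (e : R) p :
  has_imprimitivity_partition q S 1 -> (forall a, `|h a| <= 1) -> 0 < e ->
  \forall m \near \oo, forall a, `|U (m + p) h a - U m h a| <= e.
Proof.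
move=> [E [T [partE primE transT]]] h1 e0.
have e20 : 0 < e / 2 by rewrite divr_gt0.
have : \forall m \near \oo, forall C : {set A}, C \in E ->
    forall a, a \in C -> `|U (m + p) h a - U m h a| <= e / 2.
  apply: filter_forall => C; have [CE|] := boolP (C \in E); last first.
    by move=> _; apply: nearW => m.
  have [closedC [n [n0 reachC]]] := primE C CE.
  have [->|[c cC]] := set_0Vmem C; first by apply: nearW => m _ a; rewrite inE.
  have closed1 a l : a \in C -> I 1 l a \in C.
    move=> aC; apply: (closedC a aC); apply/(lettersP q2 substS).
    by exists (zceil q 1 l); [exact: zceil_box|rewrite instruction_zceil].
  have reach a : a \in C -> exists2 l, box (zpow q n) l & I n l a = c.
    by move=> aC; apply/(lettersP q2 substS); have := reachC a aC c cC; rewrite mul1n.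
  have := letter_mean_class_cvg closed1 reach p h1 e20.
  by apply: filterS => m H _.
move=> [m0 _ near_m0].
have recurrent m b : (m0 <= m)%N -> b \notin T ->
    `|U (m + p) h b - U m h b| <= e / 2.
  move=> m0m bT; have : b \in finset.cover E.
    by rewrite (finset.cover_partition partE) inE.
  by move=> /finset.bigcupP[C CE bC]; exact: (near_m0 m m0m C CE b bC).
have D_rec m a : U (m.+1 + p) h a - U m.+1 h a =
    U 1 (fun b => U (m + p) h b - U m h b) a.
  rewrite addSn -[(m + p).+1]addn1 -[m.+1]addn1 !letter_meanD//.
  by rewrite /letter_mean box_meanB.
have Umean1 m b : `|U m h b| <= 1.
  rewrite (le_trans (ler_norm_box_mean q2 _ _))// -[leRHS](box_mean_cst q2 m).
  exact: ler_box_mean.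
(* The initial excess 2 bounds the difference of two means of a function bounded by 1. *)
have bound r : forall a, `|U (m0 + r + p) h a - U (m0 + r) h a| <=
    e / 2 + 2 * (1 - eta 1) ^+ r.
  elim: r => [|r IH] a.
    rewrite expr0 mulr1 (le_trans (ler_normB _ _))//.
    by have := Umean1 (m0 + 0 + p)%N a; have := Umean1 (m0 + 0)%N a; lra.
  have e2r : e / 2 <= e / 2 + 2 * (1 - eta 1) ^+ r.+1.
    by rewrite lerDl mulr_ge0// exprn_ge0// subr_ge0 eta_le1.
  have [aT|aT] := boolP (a \in T); last first.
    by apply: le_trans e2r; apply: recurrent => //; exact: leq_addr.
  have [b [/(lettersP q2 substS)[l lb lE] bT]] := transT a aT.
  rewrite addnS D_rec (le_trans (ler_norm_box_mean q2 _ _))//.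
  have -> : e / 2 + 2 * (1 - eta 1) ^+ r.+1 =
    (e / 2 + 2 * (1 - eta 1) ^+ r) -
      eta 1 * (e / 2 + 2 * (1 - eta 1) ^+ r - e / 2) by rewrite exprS; ring.
  apply: (box_mean_le_pick q2 lb) => [|j _]; last exact: IH.
  by rewrite lE; apply: recurrent => //; exact: leq_addr.
have [r re] := eta_shrink 1 2 e20.
(* For larger [m] the surplus powers of [1 - eta 1] are at most 1. *)
exists (m0 + r)%N => // m /= rm a.
have := bound (r + (m - (m0 + r)))%N a; rewrite addnA subnKC// => /le_trans.
apply; rewrite exprD mulrA [leRHS]splitr lerD2l.
apply: le_trans re; rewrite ler_piMr ?mulr_ge0 ?exprn_ge0 ?subr_ge0 ?eta_le1//.
by rewrite exprn_ile1 ?subr_ge0 ?eta_le1// gerBl ltW// eta_gt0.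
Qed.

End LetterMeans.

Lemma filter_forall_seq {T : Type} {I : eqType} (F : set_system T) (r : seq I)
    (P : I -> set T) : Filter F ->
  (forall i, i \in r -> F (P i)) -> F [set x | forall i, i \in r -> P i x].
Proof.
move=> FF; elim: r => [|i r IH] FP; first exact: filterE.
have Pr : F [set x | forall i', i' \in r -> P i' x].
  by apply: IH => i' i'r; apply: FP; rewrite inE i'r orbT.
have Pi := FP i (mem_head _ _).
apply: filterS2 Pi Pr => x Pix Prx i'.
by rewrite inE => /predU1P[->|/Prx].
Qed.

(** * Pair frequencies of blocks and the uniform defect on X_S *)

Section PairRegularity.
Context {d : nat} {A : alphabetType} (q : Zd d) (S : A -> pconfig d A) {R : realType}.
Hypothesis q2 : forall i, 2 <= q i.
Hypothesis substS : is_substitution q S.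
Implicit Types (j k l s t : Zd d) (n m p r : nat) (a b : A).
Implicit Types (g : A -> A -> R) (x y : Zd d -> A).

Local Notation I := (instruction q S).
Local Notation mean := (@box_mean d q R).
Local Notation carry := (@carry_density d q R).

(** The pair frequency f_n(a) of the block S^n(a); when [j + k] leaves the block, [instruction]
    reads its periodic extension. *)
Definition letter_pair_mean n g k a : R :=
  pair_mean q n (fun j => I n j a) g k.

Lemma pull_pair_le1 g n s t : (forall a b, `|g a b| <= 1) ->
  forall a b, `|pull_pair q S n s t g a b| <= 1.
Proof. by move=> g1 a b; exact: g1. Qed.

Lemma pair_mean_le1 n x g k : (forall a b, `|g a b| <= 1) ->
  `|pair_mean q n x g k| <= 1.
Proof.
move=> g1; rewrite (le_trans (ler_norm_box_mean q2 _ _))//.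
by rewrite -[leRHS](box_mean_cst q2 n); exact: ler_box_mean.
Qed.

Lemma carry_small k (e : R) : 0 < e -> \forall n \near \oo, 2 * carry n k <= e.
Proof.
move=> e0; have : 2 * carry n k @[n --> \oo] --> 0.
  by rewrite -[X in _ --> X](mulr0 2); apply: cvgMr; exact: carry_density_cvg0.
move=> /cvgrPdist_le /(_ _ e0); apply: filterS => n.
by rewrite sub0r normrN; apply: le_trans; exact: ler_norm.
Qed.

Lemma subst_seq_instruction n m a :
  subst_seq q S n (fun j => I m j a) = fun j => I (n + m) j a.
Proof. by apply/funext => j; rewrite /subst_seq instructionD. Qed.

(** Fix [n] with a small boundary term: then f_(n+m) is within e/3 of U^m f_n for every [m], and the
    remaining third comes from [letter_mean_regular] applied to f_n. *)
Lemma letter_pair_mean_regular g k p (e : R) :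
  has_imprimitivity_partition q S 1 -> (forall a b, `|g a b| <= 1) -> 0 < e ->
  \forall n \near \oo, forall a,
    `|letter_pair_mean (p + n) g k a - letter_pair_mean n g k a| <= e.
Proof.
move=> impS g1 e0; have e30 : 0 < e / 3 by rewrite divr_gt0.
have [n _ /(_ n (leqnn n)) nk] := carry_small k e30.
have f1 a : `|letter_pair_mean n g k a| <= 1 by exact: pair_mean_le1.
have coarse m a : `|letter_pair_mean (n + m) g k a -
    letter_mean q S m (letter_pair_mean n g k) a| <= e / 3.
  rewrite /letter_pair_mean -(subst_seq_instruction n m a).
  exact: le_trans (pair_mean_coarse S q2 n m _ k g1) nk.
have [m0 _ reg] := letter_mean_regular q2 substS p impS f1 e30.
exists (n + m0)%N => // m /= m0m a.
have nm : (n <= m)%N by exact: leq_trans (leq_addr _ _) m0m.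
have m0mn : (m0 <= m - n)%N by rewrite leq_subRL.
have := reg _ m0mn a; have := coarse (m - n)%N a; have := coarse (m - n + p)%N a.
rewrite addnA subnKC// [(m + p)%N]addnC !ler_norml; lra.
Qed.

(** The first error term moves the window by [t] onto the block grid; the second discards pairs
    straddling two blocks. *)
Lemma window_pair_mean x n m t y (F : set (Zd d)) g k :
  (forall a b, `|g a b| <= 1) ->
  (forall j, F j -> x j = I n (j + t) (y (zfloor q n (j + t)))) ->
  (forall j, box (zpow q (n + m)) j -> F j /\ F (j + k)) ->
  `|pair_mean q (n + m) x g k - mean m (fun l => letter_pair_mean n g k (y l))|
  <= 2 * carry (n + m) t + 2 * carry n k.
Proof.
move=> g1 xE Fbox; set z := subst_seq q S n y.
have -> : pair_mean q (n + m) x g k =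
    mean (n + m) (fun j => (fun j => g (z j) (z (j + k))) (j + t)).
  apply: eq_box_mean => // j /Fbox[Fj Fjk].
  by rewrite (xE j Fj) (xE _ Fjk) /z /subst_seq addrAC.
rewrite (le_trans (ler_distD (pair_mean q (n + m) z g k) _ _))// lerD//.
  exact: box_mean_translate.
exact: pair_mean_coarse.
Qed.

(** After desubstitution the two terms are close to the means over [l] of f_n(y_l) and f_(p+n)(y_l).
    The errors are 2e/5 for each tiling and e/5 for regularity, and the window size is chosen before
    [x]. *)
Lemma pair_mean_defect g k p (e : R) : (0 < d)%N ->
  has_imprimitivity_partition q S 1 -> (forall a b, `|g a b| <= 1) -> 0 < e ->
  exists n, forall x, subst_space q S x ->
    `|pair_mean q n x g k -
      mean p (fun s => pair_mean q n x (pull_pair q S p s (s + k) g)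
                         (zfloor q p (s + k)))| <= e.
Proof.
move=> d0 impS g1 e0; have e50 : 0 < e / 5 by rewrite divr_gt0.
(* All displacements that occur on either side of the identity. *)
pose K := k :: [seq zfloor q p (s + k) | s <- box_enum (zpow q p)].
have [n [regn carryn]] : exists n,
    (forall a, `|letter_pair_mean (p + n) g k a - letter_pair_mean n g k a| <= e / 5)
    /\ (forall v, v \in K -> 2 * carry n v <= e / 5).
  have [n _ H] := filterI (letter_pair_mean_regular k p impS g1 e50)
    (filter_forall_seq _ (fun v (_ : v \in K) => carry_small v e50)).
  by exists n; exact: H (leqnn n).
(* Once [n] is fixed, only finitely many offsets [t] are possible, so one [m] serves every point of
   X_S. *)
have [m carrym] : exists m, forall t, t \in box_enum (zpow q n) ->
    2 * carry (n + m) t <= e / 5.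
  have [m _ H] := filter_forall_seq _
    (fun t (_ : t \in box_enum (zpow q n)) => carry_small t e50).
  by exists m => t tb; exact: (H (n + m)%N (leq_addl _ _) t tb).
exists (n + m)%N => x xS.
pose F := [seq j + v | j <- box_enum (zpow q (n + m)), v <- 0 :: K].
have [t [y [tb xE]]] := subst_space_desubst q2 substS n d0 xS (finite_seq F).
have window g' v : (forall a b, `|g' a b| <= 1) -> v \in K ->
    `|pair_mean q (n + m) x g' v - mean m (fun l => letter_pair_mean n g' v (y l))|
    <= e / 5 + e / 5.
  move=> g'1 vK; apply: le_trans (window_pair_mean g'1 xE _) _; last first.
    by rewrite lerD ?carryn// carrym//; apply/mem_box_zpow.
  move=> j /(mem_box_zpow q2) jb; split; last first.
    by apply/allpairsP; exists (j, v); rewrite /= inE vK orbT.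
  by apply/allpairsP; exists (j, 0); rewrite /= inE eqxx addr0.
have renorm : `|mean p (fun s => pair_mean q (n + m) x (pull_pair q S p s (s + k) g)
      (zfloor q p (s + k))) -
    mean m (fun l => letter_pair_mean (p + n) g k (y l))| <= e / 5 + e / 5.
  (* For the blocks of single letters the renormalization is exact, by [pair_mean_subst]. *)
  have -> : mean m (fun l => letter_pair_mean (p + n) g k (y l)) =
    mean p (fun s => mean m (fun l => letter_pair_mean n
      (pull_pair q S p s (s + k) g) (zfloor q p (s + k)) (y l))).
    rewrite box_mean_exchange; apply: eq_box_mean => // l _.
    by rewrite /letter_pair_mean -subst_seq_instruction pair_mean_subst.
  apply: ler_dist_box_mean => // s /(mem_box_zpow q2) sb.
  apply: window; first exact: pull_pair_le1.
  by rewrite inE (map_f (fun s => zfloor q p (s + k))) ?orbT.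
have reg : `|mean m (fun l => letter_pair_mean (p + n) g k (y l)) -
    mean m (fun l => letter_pair_mean n g k (y l))| <= e / 5.
  by apply: ler_dist_box_mean => // l _; exact: regn.
have := window g k g1 (mem_head _ _); move: renorm reg.
rewrite !ler_norml; lra.
Qed.

End PairRegularity.

(** * Topology and shift invariance of X_S *)

Section SequenceSpace.
Context {d : nat} {A : alphabetType}.
Implicit Types (j u v : Zd d).

Lemma open_coordinate u (a : A) : open [set x : seqspace d A | x u = a].
Proof.
have -> : [set x : seqspace d A | x u = a] =
    proj u @^-1` ([set a] : set (discrete_topology A)) by [].
apply: open_comp; last exact: discrete_open.
by move=> x _; exact: proj_continuous.
Qed.

Lemma open_pair u v (P : A -> A -> Prop) :
  open [set x : seqspace d A | P (x u) (x v)].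
Proof.
have -> : [set x : seqspace d A | P (x u) (x v)] =
    \bigcup_(ab in [set ab : A * A | P ab.1 ab.2])
      ([set x | x u = ab.1] `&` [set x | x v = ab.2]).
  apply/seteqP; split=> x /=; first by move=> xP; exists (x u, x v).
  by move=> [[a b] /= abP [-> ->]].
by apply: bigcup_open => ab _; apply: openI; exact: open_coordinate.
Qed.

(** A point outside X_S fails on some finite window, and every sequence agreeing with it there fails
    too. *)
Lemma closed_subst_space (q : Zd d) (S : A -> pconfig d A) :
  closed (subst_space q S : set (seqspace d A)).
Proof.
rewrite -openC openE => x /= xS.
have [F [Ffin xF]] : exists F, finite_set F /\ ~ exists n g t,
    forall j, F j -> subst_pow q S n g (j + t) = Some (x j).
  apply: contrapT => H; apply: xS => F Ffin; apply: contrapT => xF.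
  by apply: H; exists F.
have : nbhs (x : seqspace d A) (\bigcap_(j in F) [set y : seqspace d A | y j = x j]).
  have [r ->] := (finite_seqP F).1 Ffin.
  apply: filter_forall_seq => j _; apply: open_nbhs_nbhs.
  by split; first exact: open_coordinate.
apply: filterS => y yx yS; apply: xF; have [n [g [t H]]] := yS F Ffin.
by exists n, g, t => j Fj; rewrite -(yx j Fj) H.
Qed.

Lemma subst_space_shift (q : Zd d) (S : A -> pconfig d A) j x :
  subst_space q S (zshift j x) <-> subst_space q S x.
Proof.
suff shift j' y : subst_space q S y -> subst_space q S (zshift j' y).
  split=> [/(shift (- j))|]; last exact: shift.
  by congr subst_space; apply/funext => i; rewrite /zshift addrNK.
move=> yS F Ffin; have [n [g [t H]]] := yS ((fun i => i + j') @` F) (finite_image _ Ffin).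
exists n, g, (j' + t) => i Fi; rewrite addrA H//.
by exists i.
Qed.

End SequenceSpace.

(** * Integrals of finite sums and of uniformly close functions *)

Lemma Rintegral_sum disp (T : measurableType disp) (R : realType)
    (mu : {measure set T -> \bar R}) (D : set T) (I : Type) (r : seq I)
    (f : I -> T -> R) : measurable D ->
  (forall i, mu.-integrable D (EFin \o f i)) ->
  mu.-integrable D (EFin \o (fun x => \sum_(i <- r) f i x)) /\
  \int[mu]_(x in D) (\sum_(i <- r) f i x) = \sum_(i <- r) \int[mu]_(x in D) f i x.
Proof.
move=> mD intf; elim: r => [|i r [IH1 IH2]].
  rewrite big_nil; split.
    rewrite (_ : _ \o _ = cst 0%E); first exact: integrable0.
    by apply/funext => x /=; rewrite big_nil.
  under eq_Rintegral do rewrite big_nil.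
  by rewrite Rintegral_cst// mul0r.
split.
  rewrite (_ : _ \o _ = (EFin \o f i) \+ (EFin \o (fun x => \sum_(i <- r) f i x))).
    exact: integrableD.
  by apply/funext => x /=; rewrite big_cons.
under eq_Rintegral do rewrite big_cons.
by rewrite RintegralD// IH2 big_cons.
Qed.

Lemma ler_dist_Rintegral disp (T : measurableType disp) (R : realType)
    (mu : {finite_measure set T -> \bar R}) (D : set T) (f g : T -> R) (e : R) :
  measurable D -> mu.-integrable D (EFin \o f) -> mu.-integrable D (EFin \o g) ->
  (forall x, D x -> `|f x - g x| <= e) ->
  `|\int[mu]_(x in D) f x - \int[mu]_(x in D) g x| <= e * fine (mu D).
Proof.
move=> mD intf intg fg; rewrite -RintegralB//.
have intB : mu.-integrable D (EFin \o (fun x => f x - g x)).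
  rewrite (_ : _ \o _ = (EFin \o f) \- (EFin \o g))%E; first exact: integrableB.
  by apply/funext => x /=; rewrite EFinB.
apply: le_trans (le_normr_Rintegral mD intB) _.
rewrite -Rintegral_cst//; apply: le_Rintegral => //; first exact: integrable_norm.
exact/finite_measure_integrable_cst.
Qed.

(** * Integration of pair functions against an invariant measure *)

Section InvariantMeasure.
Context {d : nat} {A : alphabetType} {R : realType} (q : Zd d) (S : A -> pconfig d A).
Context (mu : probability (borel (seqspace d A)) R).
Hypothesis q2 : forall i, 2 <= q i.
Hypothesis muS : invariant_measure q S mu.
Implicit Types (j k u v : Zd d) (g : A -> A -> R) (n p : nat).

Local Notation X := (subst_space q S : set (borel (seqspace d A))).
Local Notation mean := (@box_mean d q R).

Lemma measurable_open (U : set (seqspace d A)) :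
  open U -> measurable (U : set (borel (seqspace d A))).
Proof. by move=> oU; exact: sub_sigma_algebra. Qed.

Lemma measurable_subst_space : measurable X.
Proof.
rewrite -[X]setCK; apply: measurableC; apply: measurable_open.
by rewrite openC; exact: closed_subst_space.
Qed.

Definition pair_prob u v (a b : A) : R :=
  fine (mu (X `&` [set x | x u = a /\ x v = b])).

(** The functional E(g, k), as a finite sum over pairs of letters; [Rintegral_pair] identifies it
    with an integral. *)
Definition pair_integral g k : R :=
  \sum_a \sum_b g a b * pair_prob 0 k a b.

Lemma pair_prob_translate j v a b : pair_prob j (j + v) a b = pair_prob 0 v a b.
Proof.
rewrite /pair_prob -[in RHS](muS.2 j); last first.
  apply: measurableI; first exact: measurable_subst_space.
  exact: (measurable_open (open_pair _ _ (fun a' b' => a' = a /\ b' = b))).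
congr (fine (mu _)); apply/seteqP; split=> x /=; rewrite subst_space_shift /zshift.
  by rewrite add0r [v + j]addrC.
by rewrite add0r [v + j]addrC.
Qed.

Lemma integrable_pair u v g :
  mu.-integrable X (EFin \o (fun x : borel (seqspace d A) => g (x u) (x v))).
Proof.
have mX := measurable_subst_space.
apply: measurable_bounded_integrable => //.
- by rewrite [X in (X < _)%E]muS.1 ltry.
- move=> _ Y mY; apply: measurableI => //.
  exact: (measurable_open (open_pair u v (fun a b => Y (g a b)))).
- exists (\sum_a \sum_b `|g a b|); split; first by rewrite num_real.
  move=> M /ltW ltM x _; apply: le_trans ltM.
  rewrite (bigD1 (x u))//= (bigD1 (x v))//= -addrA lerDl.
  by rewrite addr_ge0// sumr_ge0// => a _; rewrite sumr_ge0.
Qed.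

(** Expand [g] into indicators of pairs of letters; invariance of [mu] moves the site [j] to 0. *)
Lemma Rintegral_pair j v g :
  \int[mu]_(x in X) g (x j) (x (j + v)) = pair_integral g v.
Proof.
have mX := measurable_subst_space.
pose f (ab : A * A) (x : borel (seqspace d A)) : R :=
  g ab.1 ab.2 * ((x j == ab.1) && (x (j + v) == ab.2))%:R.
have intf ab : mu.-integrable X (EFin \o f ab).
  exact: (integrable_pair j (j + v)
    (fun a b => g ab.1 ab.2 * ((a == ab.1) && (b == ab.2))%:R)).
transitivity (\int[mu]_(x in X) \sum_(ab <- index_enum (A * A)%type) f ab x).
  apply: eq_Rintegral => x _; rewrite (bigD1 (x j, x (j + v)))//= /f /= !eqxx mulr1.
  rewrite big1 ?addr0// => -[a b] /=; rewrite xpair_eqE !(eq_sym (x _)).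
  by move=> /negbTE ->; rewrite mulr0.
rewrite (Rintegral_sum _ mX intf).2 /pair_integral.
rewrite (pair_bigA _ (fun a b => g a b * pair_prob 0 v a b)).
apply: eq_bigr => -[a b] _; rewrite /f /= RintegralZl//; last first.
  exact: (integrable_pair j (j + v) (fun a' b' => ((a' == a) && (b' == b))%:R)).
congr (_ * _); rewrite -(pair_prob_translate j) /pair_prob /Rintegral setIC.
rewrite -integral_indic//; last first.
  exact: (measurable_open (open_pair _ _ (fun a' b' => a' = a /\ b' = b))).
congr fine; apply: eq_integral => x _; rewrite indicE; congr ((nat_of_bool _)%:R%:E).
apply/idP/idP => [/andP[/eqP xa /eqP xb]|]; first exact/mem_set.
by move=> /set_mem [-> ->]; rewrite !eqxx.
Qed.

Lemma Rintegral_box_mean n (f : Zd d -> borel (seqspace d A) -> R) :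
  (forall j, mu.-integrable X (EFin \o f j)) ->
  mu.-integrable X (EFin \o (fun x => mean n (f ^~ x))) /\
  \int[mu]_(x in X) mean n (f ^~ x) = mean n (fun j => \int[mu]_(x in X) f j x).
Proof.
move=> intf; have mX := measurable_subst_space.
have [int1 int2] := Rintegral_sum (box_enum (zpow q n)) mX intf.
rewrite /box_mean RintegralZl// int2; split=> //.
exact: (integrableZl mX ((vol q)%:~R ^+ n)^-1 int1).
Qed.

Lemma Rintegral_pair_mean n g k :
  mu.-integrable X (EFin \o (fun x => pair_mean q n x g k)) /\
  \int[mu]_(x in X) pair_mean q n x g k = pair_integral g k.
Proof.
have [int1 int2] := Rintegral_box_mean n (fun j => integrable_pair j (j + k) g).
rewrite /pair_mean int2; split=> //.
rewrite -[RHS](box_mean_cst q2 n); apply: eq_box_mean => // j _.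
exact: Rintegral_pair.
Qed.

(** Integrate [pair_mean_defect]: the window depends on [e], but the integrals of the window means
    do not, so the two sides differ by less than any [e]. *)
Lemma pair_integral_renorm g k p : (0 < d)%N -> is_substitution q S ->
  has_imprimitivity_partition q S 1 -> (forall a b, `|g a b| <= 1) ->
  pair_integral g k =
  mean p (fun s => pair_integral (pull_pair q S p s (s + k) g) (zfloor q p (s + k))).
Proof.
move=> d0 substS impS g1; have mX := measurable_subst_space.
apply/eqP; rewrite -subr_eq0 -normr_le0; apply/ler_addgt0Pl => e e0; rewrite addr0.
have [n defect] := pair_mean_defect q2 substS k p d0 impS g1 e0.
have [int1 E1] := Rintegral_pair_mean n g k.
have [int2 E2] := Rintegral_box_mean p (fun s => (Rintegral_pair_mean n
  (pull_pair q S p s (s + k) g) (zfloor q p (s + k))).1).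
have -> : mean p (fun s => pair_integral (pull_pair q S p s (s + k) g)
    (zfloor q p (s + k))) =
  \int[mu]_(x in X) mean p (fun s => pair_mean q n x
    (pull_pair q S p s (s + k) g) (zfloor q p (s + k))).
  rewrite E2; apply: eq_box_mean => // s _.
  by rewrite (Rintegral_pair_mean n _ _).2.
(* X_S has full mass, so the uniform bound [e] passes to the integrals unchanged. *)
rewrite -E1 -[e]mulr1 (_ : 1 = fine (mu X)); last by rewrite muS.1.
exact: ler_dist_Rintegral.
Qed.

End InvariantMeasure.

(** * Replacing the coarse displacement by zero *)

Section PairIntegralZero.
Context {d : nat} {A : alphabetType} {R : realType} (q : Zd d) (S : A -> pconfig d A).
Context (mu : probability (borel (seqspace d A)) R).
Hypothesis q2 : forall i, 2 <= q i.
Hypothesis muS : invariant_measure q S mu.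
Implicit Types (k : Zd d) (g : A -> A -> R).

Local Notation X := (subst_space q S : set (borel (seqspace d A))).
Local Notation mean := (@box_mean d q R).
Local Notation E := (@pair_integral d A R q S mu).

Lemma pair_integral_le1 g k : (forall a b, `|g a b| <= 1) -> `|E g k| <= 1.
Proof.
move=> g1; have mX := measurable_subst_space q S.
have intg := integrable_pair muS 0 (0 + k) g.
rewrite -(Rintegral_pair muS 0 k g).
apply: le_trans (le_normr_Rintegral mX intg) _.
rewrite (_ : 1 = \int[mu]_(x in X) 1); last first.
  by rewrite Rintegral_cst// [X in fine X]muS.1 mulr1.
apply: le_Rintegral => //; first exact: integrable_norm.
exact/finite_measure_integrable_cst.
Qed.

(** Renormalize with [p = n]: the displacement is already 0 at every site that does not carry. *)
Lemma pair_integral_renorm0 g k n : (0 < d)%N -> is_substitution q S ->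
  has_imprimitivity_partition q S 1 -> (forall a b, `|g a b| <= 1) ->
  `|mean n (fun s => E (pull_pair q S n s (s + k) g) 0) - E g k|
    <= 2 * carry_density q n k.
Proof.
move=> d0 substS impS g1; rewrite (pair_integral_renorm q2 muS k n d0 substS impS g1).
apply: box_mean_dist_carry => //.
- by move=> j; apply: pair_integral_le1; exact: pull_pair_le1.
- by move=> j; apply: pair_integral_le1; exact: pull_pair_le1.
- by move=> j _ ->.
Qed.

End PairIntegralZero.

(** * From functions of pairs to correlation vectors *)

Section Vectors.
Context {R : realType}.

Lemma normc_real (x : R) : `|x%:C%C| = `|x|%:C%C.
Proof. by rewrite normc_def /= expr0n addr0 sqrtr_sqr. Qed.

Lemma box_mean_mx d (q : Zd d) n m (M : Zd d -> 'cV[R[i]]_m) (h : Zd d -> R) x :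
  (forall i, 2 <= q i) -> (forall j, M j x 0 = (h j)%:C%C) ->
  (((vol q)%:~R ^+ n)^-1 *: \sum_(j \in box (zpow q n)) M j) x 0 =
  (box_mean q n h)%:C%C.
Proof.
move=> q2 Mh; have <- : [set` box_enum (zpow q n)] = box (zpow q n).
  by apply/seteqP; split=> j /mem_box_zpow; exact.
rewrite -fsbig_seq ?box_enum_uniq// mxE summxE /box_mean rmorphM fmorphV rmorphXn.
by rewrite rmorph_int rmorph_sum; congr (_ * _); apply: eq_bigr.
Qed.

Definition indic_pair {A : finType} (a b c c' : A) : R := ((a == c) && (b == c'))%:R.

Lemma indic_pair_le1 (A : finType) (a b c c' : A) : `|indic_pair a b c c'| <= 1.
Proof. by rewrite /indic_pair normr_nat lern1 leq_b1. Qed.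

Lemma cvg_col (m : nat) (u : nat -> 'cV[R[i]]_m) (v : 'cV[R[i]]_m)
    (a : nat -> 'I_m -> R) (b : 'I_m -> R) :
  (forall n x, u n x 0 = (a n x)%:C%C) -> (forall x, v x 0 = (b x)%:C%C) ->
  (forall x, a n x @[n --> \oo] --> b x) -> u n @[n --> \oo] --> v.
Proof.
move=> ua vb ab; apply/cvg_ballP => e e0.
(* The radius is a complex number, and positivity in the order on complex numbers makes it real. *)
have eE : e = (complex.Re e)%:C%C.
  by case: e e0 => r s; rewrite ltcE /= => /andP[/eqP -> _].
have Re0 : 0 < complex.Re e by move: e0; rewrite {1}eE ltcR.
have : \forall n \near \oo, forall x, `|b x - a n x| < complex.Re e.
  by apply: filter_forall => x; have /cvgrPdist_lt/(_ _ Re0) := ab x.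
apply: filterS => n H; split=> // x y; rewrite ord1.
by rewrite /ball /= vb ua -rmorphB normc_real eE ltcR.
Qed.

Context {d : nat} {A : alphabetType}.
Context (q : Zd d) (S : A -> pconfig d A) (mu : probability (borel (seqspace d A)) R).
Context (Sigma : A -> A -> complex_measure R (borel (torus R d))).
Hypothesis SigmaP : is_correlation_vector q S mu Sigma.

Local Notation E := (@pair_integral d A R q S mu).
Local Notation indic x :=
  (indic_pair (enum_val (mxtens_unindex x).1) (enum_val (mxtens_unindex x).2)).

(** Both cylinders lie in X_S; shift invariance merges the two membership conditions into one. *)
Lemma fourier_pair a b k : fourier (Sigma a b) k = (pair_prob q S mu 0 k a b)%:C%C.
Proof.
rewrite SigmaP /pair_prob; congr (fine (mu _))%:C%C; apply/seteqP; split=> x /=.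
  by rewrite /cylinder /= subst_space_shift /zshift add0r => -[[? ?] [_ ?]].
by rewrite /cylinder /= subst_space_shift /zshift add0r => -[? [? ?]].
Qed.

Lemma fourier_vectorE k x : fourier_vector Sigma k x 0 = (E (indic x) k)%:C%C.
Proof.
rewrite mxE /= fourier_pair; congr (_%:C%C); rewrite /pair_integral.
rewrite (bigD1 (enum_val (mxtens_unindex x).1))//=.
rewrite (bigD1 (enum_val (mxtens_unindex x).2))//= /indic_pair !eqxx mul1r.
rewrite [X in _ + X + _]big1 => [|b /negbTE bx].
  rewrite addr0 big1 ?addr0// => a /negbTE ax.
  by rewrite big1// => b _; rewrite eq_sym ax mul0r.
by rewrite [_ == b]eq_sym bx mul0r.
Qed.

(** Row [x] of the Kronecker product is the indicator of the pair [x] pulled back by the two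
    instructions; pairing it with the vector of joint probabilities gives E. *)
Lemma instruction_fourierE n s t k x :
  ((instruction_mx q R S n s *t instruction_mx q R S n t)
     *m fourier_vector Sigma k) x 0 =
  (E (pull_pair q S n s t (indic x)) k)%:C%C.
Proof.
pose F (a b : A) : R := pull_pair q S n s t (indic x) a b * pair_prob q S mu 0 k a b.
transitivity (\sum_(i < #|A|) \sum_(j < #|A|) (F (enum_val i) (enum_val j))%:C%C).
  rewrite mxE (reindex (fun ij => mxtens_index ij)) /=; last first.
    exists (@mxtens_unindex _ _) => y _; first exact: mxtens_indexK.
    exact: mxtens_unindexK.
  rewrite pair_bigA; apply: eq_bigr => -[i j] _ /=.
  rewrite !mxE mxtens_indexK /= fourier_pair -natrM mulnb /F rmorphM.
  by rewrite /pull_pair /indic_pair rmorph_nat.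
rewrite /pair_integral rmorph_sum [RHS](reindex _ (onW_bij _ (@enum_val_bij A))).
apply: eq_bigr => i _; rewrite rmorph_sum.
by rewrite [RHS](reindex _ (onW_bij _ (@enum_val_bij A))).
Qed.

End Vectors.

Theorem theorem3p6 (R : realType) (d : nat) (A : alphabetType) (q : Zd d)
    (S : A -> pconfig d A) (mu : probability (borel (seqspace d A)) R)
    (Sigma : A -> A -> complex_measure R (borel (torus R d))) :
  (0 < d)%N ->
  (forall i, 2 <= q i) ->
  (1 < #|A|)%N ->
  is_substitution q S ->
  aperiodic q S ->
  index_of_imprimitivity q S 1 ->
  invariant_measure q S mu ->
  is_correlation_vector q S mu Sigma ->
  forall (p : nat) (k : Zd d),
    fourier_vector Sigma k =
      ((vol q)%:~R ^+ p)^-1 *: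
        (\sum_(j \in box (zpow q p))
           (instruction_mx q R S p j *t instruction_mx q R S p (j + k))
             *m fourier_vector Sigma (zfloor q p (j + k)))
    /\
    (fun n : nat =>
       ((vol q)%:~R ^+ n)^-1 *:
         (\sum_(j \in box (zpow q n))
            (instruction_mx q R S n j *t instruction_mx q R S n (j + k))
              *m fourier_vector Sigma 0))
      @ \oo --> fourier_vector Sigma k.
Proof.
move=> d0 q2 _ substS _ [_ impS _] muS SigmaP p k; split.
  (* Each coordinate is the scalar identity for the indicator of one pair of letters. *)
  apply/matrixP => x y; rewrite (ord1 y).
  rewrite (box_mean_mx _ q2 (fun j => instruction_fourierE SigmaP p j (j + k) _ x)).
  rewrite (fourier_vectorE SigmaP).
  rewrite (pair_integral_renorm q2 muS k p d0 substS impS)// => a b.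
  exact: indic_pair_le1.
apply: cvg_col => [n x|x|x].
- exact: (box_mean_mx _ q2 (fun j => instruction_fourierE SigmaP n j (j + k) 0 x)).
- exact: fourier_vectorE SigmaP k x.
(* The distance to the limit is at most twice the carry density of [k], which tends to 0. *)
apply/cvgrPdist_le => e e0; apply: filterS (carry_small q2 k e0) => n.
apply: le_trans; rewrite distrC.
by apply: pair_integral_renorm0 => // a b; exact: indic_pair_le1.
Qed.
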